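(* Let $\mathcal{F}$ and $\mathcal{G}$ be two $FU$-filters on $\omega$. If $\mathcal{F}\leq_{TU}\mathcal{G}$, then $\mathcal{F}\leq_{RK}\mathcal{G}$.
   Context: All filters are proper free filters on $\omega$ (they contain all cofinite sets). $A\subseteq^* B$ means $A\setminus B$ is finite. For a filter $\mathcal{F}$, $\mathcal{F}^+$ is the set of all $A\subseteq\omega$ with $A\cap F\neq\emptyset$ for every $F\in\mathcal{F}$. A filter $\mathcal{F}$ is an $FU$-filter (Fréchet-Urysohn filter) if for every $A\in\mathcal{F}^+$ there is an infinite $S\subseteq A$ with $S\subseteq^* F$ for all $F\in\mathcal{F}$. For $A\in\mathcal{F}^+$, $\mathcal{F}|_A=\{F\cap A:F\in\mathcal{F}\}$ (a filter on $A$). For a function $f:A\to B$ and a filter $\mathcal{H}$ on $A$, $f[\mathcal{H}]=\{X\subseteq B:f^{-1}(X)\in\mathcal{H}\}$. $\mathcal{F}\leq_{RK}\mathcal{G}$ means there is a surjection $f:\omega\to\omega$ with $f[\mathcal{G}]=\mathcal{F}$. The Todorčević–Uzcátegui pre-order is: $\mathcal{F}\leq_{TU}\mathcal{G}$ if there are $A\in\mathcal{G}^+$, $B\in\mathcal{F}$ and a bijection $f:A\to B$ with $f[\mathcal{G}|_A]=\mathcal{F}|_B$; by convention the witnessing set $B$ is always taken to be $\omega$, i.e. $\mathcal{F}\leq_{TU}\mathcal{G}$ means there are $A\in\mathcal{G}^+$ and a bijection $f:A\to\omega$ with $f[\mathcal{G}|_A]=\mathcal{F}$. *)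

(* Defs.v *)
From mathcomp Require Import all_boot.
From mathcomp Require Import boolp classical_sets functions cardinality filter.

Set Implicit Arguments.
Unset Strict Implicit.
Unset Printing Implicit Defensive.

Local Open Scope classical_set_scope.

Definition free_filter (F : set_system nat) : Prop :=
  ProperFilter F /\ @frechet_filter nat `<=` F.

(* F^+ *)
Definition positive_sets (F : set_system nat) : set_system nat :=
  [set A | forall X, F X -> A `&` X !=set0].

Definition almost_subset (A B : set nat) : Prop := finite_set (A `\` B).

Definition FU_filter (F : set_system nat) : Prop :=
  free_filter F /\
  forall A, positive_sets F A ->
    exists S : set nat,
      [/\ infinite_set S, S `<=` A & forall X, F X -> almost_subset S X].

(* F|_A, a filter on A represented as a family of subsets of A inside nat *)
Definition filter_trace (F : set_system nat) (A : set nat) : set_system nat :=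
  [set X `&` A | X in F].

(* f[H] for f : A -> nat and H a filter on A. The function f is total on nat,
   but its values outside A are irrelevant: the preimage is taken inside A. *)
Definition image_on (A : set nat) (f : nat -> nat) (H : set_system nat) :
    set_system nat :=
  [set X | H (A `&` f @^-1` X)].

Definition RK_le (F G : set_system nat) : Prop :=
  exists f : nat -> nat, set_surj setT setT f /\ fmap f G = F.

(* The witnessing set on the side of F is taken to be the whole of nat. *)
Definition TU_le (F G : set_system nat) : Prop :=
  exists (A : set nat) (f : nat -> nat),
    [/\ positive_sets G A, set_bij A setT f &
        image_on A f (filter_trace G A) = F].

(* Main.v *)
Require Import Defs.
From mathcomp Require Import all_boot.
From mathcomp Require Import boolp classical_sets functions cardinality filter.

(* A bijection f from a G-positive set A onto nat with f[G|_A] = F is extended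
   to nat by an injection of nat into an infinite S almost contained in every
   member of F.  Off A, the preimage of a member of F is then cofinite, so the
   extension pushes G forward to F. *)

Local Open Scope classical_set_scope.

Lemma infinite_set_injection (S : set nat) :
  infinite_set S -> exists e : nat -> nat, injective e /\ forall n, S (e n).
Proof.
move=> /infiniteP/pcard_leP[e]; exists e; split; last by move=> n; exact: funS.
by move=> x y; apply: (@inj _ _ _ e); rewrite in_setT.
Qed.

(** Points outside the preimage are sent injectively into the part of [S] outside [X], which is
    finite. *)
Lemma almost_subset_preimage_cofinite (S X : set nat) (e : nat -> nat) :
  injective e -> (forall n, S (e n)) -> almost_subset S X ->
  @frechet_filter nat (e @^-1` X).
Proof.
move=> einj eS SX; rewrite /frechet_filter /=.
apply: (sub_finite_set (B := e @^-1` (S `\` X))) => [n nX|]; first by split.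
by apply: finite_preimage SX => x y _ _; exact: einj.
Qed.

Theorem corollary4p5 (F G : set_system nat) :
  FU_filter F -> FU_filter G -> TU_le F G -> RK_le F G.
Proof.
move=> [[FF _] FFU] [[GF Gfree] _] [A [f [_ [_ _ fsurj] fGF]]].
(* [setT] is positive, since members of a proper filter are nonempty. *)
have [S [Sinf _ SF]] : exists S : set nat,
    [/\ infinite_set S, S `<=` setT & forall X, F X -> almost_subset S X].
  by apply: FFU => X FX; rewrite setTI; exact: filter_ex FX.
have [e [einj eS]] := infinite_set_injection _ Sinf.
pose g n := if `[< A n >] then f n else e n.
have gA n : A n -> g n = f n by move=> An; rewrite /g asboolT.
exists g; split.
  by move=> y /fsurj[x Ax <-]; exists x => //; exact: gA.
apply/seteqP; split => X.
  (* The trace on [A] only sees the values of [g] on [A], where [g] is [f]. *)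
  move=> GX; rewrite -fGF; exists (g @^-1` X) => //.
  by apply/seteqP; split=> n /= [H1 H2]; split=> //; move: H1 H2 => /=;
    [move=> + An; rewrite gA|move=> An; rewrite gA].
move=> FX; have := FX; rewrite -{1}fGF => -[Y GY YA].
(* A point of [Y] in [A] goes into [X] under [f]; off [A], the cofinite preimage under [e] takes
   over. *)
have GeX := Gfree _ (almost_subset_preimage_cofinite _ _ _ einj eS (SF _ FX)).
apply: (@filterS _ G _ _ _ _ (filterI GY GeX)) => n [Yn eXn] /=.
rewrite /g; case: asboolP => // An.
by have [] : (A `&` f @^-1` X) n by rewrite -YA.
Qed.
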